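(* Let $(f,e,\alpha) \in \mathcal{B}^-(\Delta_\xi, r)$, so that $e_1 = \min f < e_2$, and let $\pi \in S_{D+1}$. Write $\pi(e) = (\pi(e_1),\pi(e_2))$, $\varepsilon = \varepsilon(\pi(e))$, $(e_1^\pi, e_2^\pi) = \pi(e)^{\uparrow}$ and $m^\pi = \min \pi(f)$. Then $$A_{\pi^{-1}}^*\big(w(\xi; f,e,\alpha)\big) = \varepsilon\, b(\lambda;\pi(\alpha))\, \varphi(\lambda; \pi(e)^{\uparrow}),$$ and exactly one of the following holds. 1. (Relabelled.) If $e_1^\pi = m^\pi$, equivalently if $\pi^{-1}(m^\pi) \in \{e_1,e_2\}$, the pair $(\pi(f), \pi(e)^{\uparrow})$ is anchored and $$A_{\pi^{-1}}^*\, w(\xi; f,e,\alpha) = \varepsilon\, w(\lambda; \pi(f), \pi(e)^{\uparrow}, \pi(\alpha)),$$ with $(\pi(f), \pi(e)^{\uparrow}, \pi(\alpha)) \in \mathcal{B}^-(\Delta_\lambda, r)$. 2. (Filter hit.) Otherwise, and independently of $\alpha$, $$A_{\pi^{-1}}^*\big(w(\xi; f,e,\alpha)\big) = \varepsilon\Big( w\big(\lambda; \pi(f), (m^\pi, e_2^\pi), \rho(m^\pi, e_1^\pi)\circ\pi(\alpha)\big) - w\big(\lambda; \pi(f), (m^\pi, e_1^\pi), \rho(m^\pi, e_2^\pi)\circ\pi(\alpha)\big)\Big),$$ with both triplets on the right in $\mathcal{B}^-(\Delta_\lambda, r)$.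
   Context: $D \ge 1$ and $r \ge 1$ are integers and $\Delta = [v_0,\dots,v_D] \subset \mathbb{R}^D$ is a non-degenerate $D$-simplex with vertex labels $0,\dots,D$, naturally ordered. Its barycentric coordinates $\xi = (\xi_0,\dots,\xi_D)$ are the affine functions with $\xi_i(v_j) = \delta_{ij}$. A face is identified with its label set $f \subseteq \{0,\dots,D\}$; $\dim f = |f|-1$, $\min f$ is the smallest label. A multi-exponent is $\alpha \in \mathbb{N}_0^{D+1}$ with $|\alpha| = \sum_i \alpha_i$, $\operatorname{supp}(\alpha) = \{i : \alpha_i > 0\}$; $b(\xi;\alpha) = \xi^\alpha = \prod_i \xi_i^{\alpha_i}$. Whitney forms: $\varphi(\xi; i,j) = \xi_i\,\mathrm{d}\xi_j - \xi_j\,\mathrm{d}\xi_i$ for $i \ne j$; $\varphi(\xi;e) = \varphi(\xi;e_1,e_2)$ for an ordered pair $e=(e_1,e_2)$ of distinct labels. $e^{\uparrow}$ is the pair sorted in increasing order. $\varepsilon(e) = +1$ if $e_1 < e_2$ and $-1$ otherwise. Shift operator: $\rho(i,j)\circ\alpha = \alpha - 1_i + 1_j$, where $1_i$ is the $i$-th unit vector. $\mathcal{S}^-(\Delta_\xi, r)$ is the set of triplets $(f,e,\alpha)$ with $\dim f \ge 1$, $e=(e_1,e_2)$ an ordered pair of distinct labels of $f$, $|\alpha| = r-1$ and $\operatorname{supp}(\alpha) \cup \{e_1,e_2\} = f$; to each is associated the 1-form $w(\xi; f,e,\alpha) = b(\xi;\alpha)\,\varphi(\xi;e_1,e_2)$.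 A pair $(f,e)$ is anchored if $e_1 < e_2$ and $e_1 = \min f$. $\mathcal{B}^-(\Delta_\xi, r)$ is the subset of triplets of $\mathcal{S}^-(\Delta_\xi, r)$ with $(f,e)$ anchored. Relabelling: $S_{D+1}$ is the group of bijections of $\{0,\dots,D\}$. $\Delta_\xi$ and $\Delta_\lambda$ are two copies of $\Delta$ whose barycentric coordinates are denoted $\xi$ and $\lambda$; all definitions above are also used on $\Delta_\lambda$ with $\lambda$ in place of $\xi$. $A_\pi : \Delta_\xi \to \Delta_\lambda$ is the affine map with $A_\pi(v_i) = v_{\pi(i)}$; $A_{\pi^{-1}} = A_\pi^{-1} : \Delta_\lambda \to \Delta_\xi$, and the pullback $A_{\pi^{-1}}^*$ takes forms on $\Delta_\xi$ to forms on $\Delta_\lambda$; it is the substitution $\xi_i \mapsto \lambda_{\pi(i)}$, $\mathrm{d}\xi_i \mapsto \mathrm{d}\lambda_{\pi(i)}$. On label sets, $\pi(f) = \{\pi(i) : i\in f\}$; on vectors indexed by labels, $\pi(\alpha)_i = \alpha_{\pi^{-1}(i)}$. *)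

(* Defs.v *)
From HB Require Import structures.
From mathcomp Require Import all_boot all_order all_algebra all_fingroup.
From mathcomp Require Import all_classical all_reals all_analysis.
Set Implicit Arguments. Unset Strict Implicit. Unset Printing Implicit Defensive.
Import Order.TTheory GRing.Theory Num.Theory.
Import numFieldNormedType.Exports.
Local Open Scope ring_scope.

Definition label_pair (D : nat) := ('I_D.+1 * 'I_D.+1)%type.
Definition multiexp (D : nat) := {ffun 'I_D.+1 -> nat}.
Definition triplet (D : nat) := ({set 'I_D.+1} * label_pair D * multiexp D)%type.

Section Combinatorics.
Variable D : nat.
Implicit Types (f : {set 'I_D.+1}) (e : label_pair D) (alpha : multiexp D)
  (s : 'S_D.+1).

(* [.-1] truncates, so the empty label set also gets dimension 0; it is
   excluded wherever [1 <= face_dim f] is required. *)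
Definition face_dim f : nat := #|f|.-1.

(* The default [ord0] is only reached when [f] is empty. *)
Definition min_label f : 'I_D.+1 :=
  odflt ord0 [pick i in f | [forall j in f, (i <= j)%N]].

Definition mdegree alpha : nat := (\sum_i alpha i)%N.
Definition msupp alpha : {set 'I_D.+1} := [set i | (0 < alpha i)%N].

(* The subtraction is on [nat]: this is alpha - 1_i + 1_j as soon as
   [0 < alpha i]; otherwise (for [i != j]) the degree goes up by one, and the
   result cannot occur in a triplet of the same degree as [alpha]. *)
Definition mshift (i j : 'I_D.+1) alpha : multiexp D :=
  [ffun k => (alpha k - (k == i) + (k == j))%N].

Definition sort_pair e : label_pair D :=
  if (e.1 < e.2)%N then e else (e.2, e.1).

Definition anchored f e : bool := (e.1 < e.2)%N && (e.1 == min_label f).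

Definition Sminus (r : nat) : {pred triplet D} :=
  [pred t | let: (f, e, alpha) := t in
    [&& (1 <= face_dim f)%N, e.1 != e.2, e.1 \in f, e.2 \in f,
        mdegree alpha == r.-1 & msupp alpha :|: [set e.1; e.2] == f]].

Definition Bminus (r : nat) : {pred triplet D} :=
  [pred t | (t \in Sminus r) && anchored t.1.1 t.1.2].

Definition relabel_face s f : {set 'I_D.+1} := [set s i | i in f].
Definition relabel_pair s e : label_pair D := (s e.1, s e.2).
Definition relabel_exp s alpha : multiexp D := [ffun i => alpha ((s^-1)%g i)].

End Combinatorics.

Arguments Sminus D r : clear implicits.
Arguments Bminus D r : clear implicits.

Section Geometry.
Variables (R : realType) (D : nat).
Local Notation point := 'rV[R]_D.
Implicit Types (v : 'I_D.+1 -> point) (xi : 'I_D.+1 -> point -> R^o).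

Definition is_affine (U V : lmodType R) (g : U -> V) : Prop :=
  exists (l : {linear U -> V}) (c : V), forall x, g x = l x + c.

Definition nondegenerate_simplex v : Prop :=
  row_free (\matrix_(i < D) (v (lift ord0 i) - v ord0)).

Definition simplex v : set point :=
  [set x | exists2 t : 'I_D.+1 -> R,
     (forall i, 0 <= t i) /\ \sum_i t i = 1 & x = \sum_i t i *: v i]%classic.

Definition is_barycentric v xi : Prop :=
  (forall i, is_affine (xi i)) /\ forall i j, xi i (v j) = (i == j)%:R.

Definition is_relabelling_map v (s : 'S_D.+1) (A : point -> point) : Prop :=
  is_affine A /\ forall i, A (v i) = v (s i).

(* Differential forms are fields of covectors on the ambient space; they are
   compared as forms on the simplex, i.e. at the points of [simplex v]. *)
Definition one_form := point -> 'Hom(point, R^o).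

Definition ext_d (g : point -> R^o) : one_form := fun x => linfun ('d g x).

Definition fmul (g : point -> R^o) (om : one_form) : one_form :=
  fun x => g x *: om x.

Definition pullback (F : point -> point) (om : one_form) : one_form :=
  fun x => (om (F x) \o linfun ('d F x))%VF.

Definition eq_on v (om1 om2 : one_form) : Prop :=
  forall x, simplex v x -> om1 x = om2 x.

Definition bern xi (alpha : multiexp D) : point -> R^o :=
  fun x => \prod_i xi i x ^+ alpha i.

Definition whitney xi (e : label_pair D) : one_form :=
  fmul (xi e.1) (ext_d (xi e.2)) - fmul (xi e.2) (ext_d (xi e.1)).

(* The face [f] is only a label of the triplet: it does not affect the form. *)
Definition wform xi (f : {set 'I_D.+1}) (e : label_pair D)
    (alpha : multiexp D) : one_form :=
  fmul (bern xi alpha) (whitney xi e).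

Definition pair_sign (e : label_pair D) : R := if (e.1 < e.2)%N then 1 else -1.

End Geometry.

Definition exactly_one (P Q : Prop) : Prop := (P /\ ~ Q) \/ (~ P /\ Q).

(* Main.v *)
(* The affine maps xi_i o A_(p^-1) and lam_(p i) agree on the vertices, hence
   everywhere, so the chain rule turns the pullback into the substitution of
   lam_(p i) for xi_i. When min p(f) = m is not an endpoint of p(e), m lies in
   the support of p(alpha); with b = lam^(p(alpha) - 1_m), the rewriting is
   b lam_m (x dy - y dx) = b x (lam_m dy - y dlam_m) - b y (lam_m dx - x dlam_m),
   where the dlam_m terms cancel. *)
Require Import Defs.
From HB Require Import structures.
From mathcomp Require Import all_boot all_order all_algebra all_fingroup.
From mathcomp Require Import all_classical all_reals all_analysis.
Set Implicit Arguments. Unset Strict Implicit. Unset Printing Implicit Defensive.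
Import Order.TTheory GRing.Theory Num.Theory.
Import numFieldNormedType.Exports.
Local Open Scope ring_scope.

(** * Affine maps: differentiability, and determination by the vertices *)

Lemma linear_rV_continuous (R : realType) (D : nat) (V : normedModType R)
    (l : {linear 'rV[R]_D -> V}) : continuous l.
Proof.
have -> : (l : 'rV[R]_D -> V) =
    fun x => \sum_(j < D) (x 0 j *: l (delta_mx 0 j)).
  apply/funext => x; rewrite {1}[x]row_sum_delta linear_sum.
  by apply: eq_bigr => j _; rewrite linearZ.
apply: continuous_big => [|j _ x]; first exact: add_continuous.
by apply: continuousZr_tmp; apply: coord_continuous.
Qed.

Lemma affine_differentiable (R : realType) (D : nat) (V : normedModType R)
    (g : 'rV[R]_D -> V) (x : 'rV[R]_D) : is_affine g -> differentiable g x.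
Proof.
case=> l [c gE].
have -> : g = (l : 'rV[R]_D -> V) + cst c.
  by apply/funext => y; rewrite gE.
apply: differentiableD; last exact: differentiable_cst.
exact/linear_differentiable/linear_rV_continuous.
Qed.

Lemma affine_comp (R : realType) (U V W : lmodType R) (g : V -> W)
    (h : U -> V) : is_affine g -> is_affine h -> is_affine (g \o h).
Proof.
case=> l [c gE] [k [d hE]].
exists (l \o k : {linear U -> W}), (l d + c) => x.
by rewrite /= gE hE linearD addrA.
Qed.

(** Nondegeneracy makes the edge vectors issued from [v ord0] a basis. The linear parts agree on
    these edges, hence everywhere; the value at [v ord0] then fixes the constants. *)
Lemma affine_eq_on_vertices (R : realType) (D : nat) (V : lmodType R)
    (v : 'I_D.+1 -> 'rV[R]_D) (g h : 'rV[R]_D -> V) :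
  nondegenerate_simplex v -> is_affine g -> is_affine h ->
  (forall i, g (v i) = h (v i)) -> g =1 h.
Proof.
move=> vfree [l [c gE]] [k [d hE]] gh.
set M := \matrix_(i < D) (v (lift ord0 i) - v ord0) in vfree.
have lk0 i : l (row i M) = k (row i M).
  rewrite rowK !linearB; have := gh (lift ord0 i); have := gh ord0.
  rewrite !gE !hE => /(canRL (addrK _)) -> /(canRL (addrK _)) ->.
  by rewrite -!(addrA _ d) opprD addrACA subrr addr0.
have lk x : l x = k x.
  (* [M] is square, so free rows also span the whole space. *)
  have /submxP[u ->] : (x <= M)%MS.
    by apply: submx_full; rewrite row_full_unit -row_free_unit.
  rewrite mulmx_sum_row !linear_sum; apply: eq_bigr => i _.
  by rewrite !linearZ lk0.
by have := gh ord0; rewrite !gE !hE lk => /addrI cd x; rewrite gE hE lk cd.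
Qed.

Lemma barycentric_relabel (R : realType) (D : nat) (v : 'I_D.+1 -> 'rV[R]_D)
    (xi lam : 'I_D.+1 -> 'rV[R]_D -> R^o) (p : 'S_D.+1)
    (F : 'rV[R]_D -> 'rV[R]_D) :
  nondegenerate_simplex v -> is_barycentric v xi -> is_barycentric v lam ->
  is_relabelling_map v (p^-1)%g F ->
  forall i, xi i \o F = lam (p i).
Proof.
move=> hv [xiA xiE] [lamA lamE] [FA FE] i; apply/funext.
apply: (affine_eq_on_vertices hv) => [||j /=]; [exact: affine_comp|exact: lamA|].
by rewrite FE xiE lamE (can2_eq (permK p) (permKV p)).
Qed.

(** * Algebraic identities used pointwise on forms *)

Lemma comp_lfun_lincomb (K : fieldType) (U V W : vectType K) (a b : K)
    (g h : 'Hom(V, W)) (k : 'Hom(U, V)) :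
  ((a *: g - b *: h) \o k)%VF = a *: (g \o k)%VF - b *: (h \o k)%VF.
Proof. by rewrite comp_lfunDl comp_lfunNl !comp_lfunZl. Qed.

(** Isolates one factor, so that a monomial and its shifts can be compared through a common monomial
    of degree one less. *)
Lemma prod_expr_succ (K : comNzRingType) (I : finType) (y : I -> K)
    (a : I -> nat) (j : I) :
  \prod_i y i ^+ (a i + (i == j)) = (\prod_i y i ^+ a i) * y j.
Proof.
under eq_bigr do rewrite exprD.
rewrite big_split /=; congr (_ * _).
rewrite (bigD1 j) //= eqxx expr1 big1 ?mulr1 // => i /negPf ->.
by rewrite expr0.
Qed.

Lemma whitney_exchange (K : comNzRingType) (V : lmodType K) (b x y z : K)
    (dx dy dz : V) :
  (b * z) *: (x *: dy - y *: dx) =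
  (b * x) *: (z *: dy - y *: dz) - (b * y) *: (z *: dx - x *: dz).
Proof.
rewrite !scalerBr !scalerA !(mulrAC b z) (mulrAC b x y).
by rewrite opprB addrA subrK.
Qed.

(** * Pullback, sorting and rewriting of Whitney forms *)

Section Forms.
Variables (R : realType) (D : nat).
Implicit Types (xi lam : 'I_D.+1 -> 'rV[R]_D -> R^o) (e : label_pair D)
  (alpha : multiexp D) (x : 'rV[R]_D).

Lemma whitneyE xi e x :
  whitney xi e x =
  xi e.1 x *: ext_d (xi e.2) x - xi e.2 x *: ext_d (xi e.1) x.
Proof. by []. Qed.

Lemma fmulZ (g : 'rV[R]_D -> R^o) (c : R) (om : one_form R D) :
  fmul g (c *: om) = c *: fmul g om.
Proof.
apply/funext => x; apply: (etrans (scalerA _ _ _)).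
by rewrite mulrC -scalerA.
Qed.

Lemma pullback_ext_d (g : 'rV[R]_D -> R^o) (F : 'rV[R]_D -> 'rV[R]_D) :
  is_affine g -> is_affine F -> pullback F (ext_d g) = ext_d (g \o F).
Proof.
move=> gA FA; apply/funext => x; apply/lfunP => u.
have dgF : 'd (g \o F) x = 'd g (F x) \o 'd F x :> ('rV[R]_D -> R^o).
  by apply: diff_comp; apply: affine_differentiable.
apply: (etrans (comp_lfunE _ _ _)); apply: (etrans (lfunE ('d g (F x)) _)).
apply: (etrans (congr1 _ (lfunE ('d F x) u))).
apply: (etrans _ (esym (lfunE ('d (g \o F) x) u))).
exact: esym (congr1 (@^~ u) dgF).
Qed.

Lemma pullback_wform xi lam (p : 'S_D.+1) (F : 'rV[R]_D -> 'rV[R]_D) f e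
    alpha :
  (forall i, is_affine (xi i)) -> is_affine F ->
  (forall i, xi i \o F = lam (p i)) ->
  pullback F (wform xi f e alpha) =
  fmul (bern lam (relabel_exp p alpha)) (whitney lam (relabel_pair p e)).
Proof.
move=> xiA FA xiF; apply/funext => x.
have xiFx i : xi i (F x) = lam (p i) x by rewrite -xiF.
rewrite /pullback /wform /fmul -comp_lfunZl; congr (_ *: _).
  (* After reindexing, the factor at label [p i] carries the exponent [alpha i]. *)
  rewrite /bern [RHS](reindex_perm p); apply: eq_bigr => i _.
  by rewrite ffunE permK xiFx.
have dxiF i : (ext_d (xi i) (F x) \o linfun ('d F x))%VF = ext_d (lam (p i)) x.
  by rewrite -xiF -pullback_ext_d.
apply: (etrans (comp_lfun_lincomb _ _ _ _ _)).
by rewrite !xiFx; congr (_ *: _ - _ *: _); apply: dxiF.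
Qed.

(** Antisymmetry of the Whitney form in its two labels is what produces the sign. *)
Lemma whitney_sort lam e :
  whitney lam e = pair_sign R e *: whitney lam (sort_pair e).
Proof.
rewrite /pair_sign /sort_pair; case: ifP => _; first by rewrite scale1r.
by apply/funext => x; rewrite scaleN1r fctE !whitneyE opprB.
Qed.

Lemma whitney_filter_hit lam f (m : 'I_D.+1) e alpha :
  (0 < alpha m)%N ->
  fmul (bern lam alpha) (whitney lam e) =
  wform lam f (m, e.2) (mshift m e.1 alpha)
  - wform lam f (m, e.1) (mshift m e.2 alpha).
Proof.
move=> am; apply/funext => x.
pose b := \prod_i lam i x ^+ (alpha i - (i == m)).
have shiftE j : bern lam (mshift m j alpha) x = b * lam j x.
  by rewrite -prod_expr_succ; apply: eq_bigr => i _; rewrite ffunE.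
have bernE : bern lam alpha x = b * lam m x.
  rewrite -prod_expr_succ; apply: eq_bigr => i _.
  (* Since [alpha m] is positive, the truncated subtraction at [m] is undone by adding one back. *)
  by case: eqVneq => [->|_]; rewrite ?subn0 ?addn0 // subnK.
rewrite /fmul bernE.
apply: (etrans (whitney_exchange _ _ _ _ _ _ _)).
by rewrite -!shiftE.
Qed.

End Forms.

(** * Combinatorics of faces and triplets *)

Lemma min_labelP (D : nat) (f : {set 'I_D.+1}) (i : 'I_D.+1) :
  i \in f -> min_label f \in f /\ forall j, j \in f -> (min_label f <= j)%N.
Proof.
move=> fi; rewrite /min_label; case: pickP => [j /andP[fj /forall_inP] //|].
(* A nonempty face has a least label, so the search cannot fail and the default [ord0] is never
   returned. *)
case: (arg_minnP (fun j : 'I_D.+1 => j : nat) fi) => j fj jmin /(_ j)/negP[].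
by apply/andP; split=> //; apply/forall_inP.
Qed.

Lemma mem_relabel_face (D : nat) (s : 'S_D.+1) (f : {set 'I_D.+1}) i :
  (i \in relabel_face s f) = ((s^-1)%g i \in f).
Proof. by rewrite -{1}(permKV s i) mem_imset //; exact: perm_inj. Qed.

Lemma sort_pair_lt (D : nat) (e : label_pair D) :
  e.1 != e.2 -> ((sort_pair e).1 < (sort_pair e).2)%N.
Proof. by rewrite /sort_pair -val_eqE neq_ltn; case: ltnP. Qed.

Lemma sort_pair_set (D : nat) (e : label_pair D) :
  [set (sort_pair e).1; (sort_pair e).2] = [set e.1; e.2].
Proof. by rewrite /sort_pair; case: ifP => // _; rewrite finset.setUC. Qed.

Lemma Sminus_relabel (D r : nat) (p : 'S_D.+1) (f : {set 'I_D.+1})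
    (e : label_pair D) (alpha : multiexp D) :
  (f, e, alpha) \in Sminus D r ->
  (relabel_face p f, sort_pair (relabel_pair p e), relabel_exp p alpha)
    \in Sminus D r.
Proof.
rewrite !inE => /and5P[fdim e12 e1f e2f /andP[/eqP dega /eqP suppa]].
have q12 : (relabel_pair p e).1 != (relabel_pair p e).2.
  by rewrite (inj_eq perm_inj).
have suppq : msupp (relabel_exp p alpha) :|:
    [set (sort_pair (relabel_pair p e)).1; (sort_pair (relabel_pair p e)).2] =
    relabel_face p f.
  rewrite sort_pair_set; apply/setP => i.
  rewrite mem_relabel_face -suppa !inE ffunE.
  by rewrite !(can2_eq (permKV p) (permK p)).
(* With the face written as support plus endpoints, both endpoints visibly belong to it. *)
rewrite -suppq; apply/and5P; split; rewrite ?inE ?eqxx ?orbT //.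
- by rewrite suppq /face_dim card_imset //; exact: perm_inj.
- by rewrite -val_eqE neq_ltn sort_pair_lt.
- rewrite andbT -dega /mdegree [X in _ == X](reindex_perm (p^-1)%g).
  by apply/eqP/eq_bigr => i _; rewrite ffunE.
Qed.

Lemma Sminus_swap (D r : nat) (f : {set 'I_D.+1}) (i j : 'I_D.+1)
    (alpha : multiexp D) :
  (f, (i, j), alpha) \in Sminus D r -> (f, (j, i), alpha) \in Sminus D r.
Proof.
rewrite !inE /= => /and5P[-> ij -> -> /andP[-> suppa]].
by rewrite eq_sym ij [[set j; i]]finset.setUC suppa.
Qed.

(** The labels [m] and [i] trade roles: [m] may leave the support but becomes an endpoint, while [i]
    stops being an endpoint but enters the support. The face is therefore unchanged, and positivity
    of [alpha m] preserves the degree. *)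
Lemma Sminus_mshift (D r : nat) (f : {set 'I_D.+1}) (m i j : 'I_D.+1)
    (alpha : multiexp D) :
  (f, (i, j), alpha) \in Sminus D r -> (0 < alpha m)%N -> m != j ->
  (f, (m, j), mshift m i alpha) \in Sminus D r.
Proof.
rewrite !inE /= => /and5P[fdim ij i_f j_f /andP[/eqP dega /eqP suppa]] am mj.
have mf : m \in f by rewrite -suppa !inE am.
have alphaE k : (alpha k - (k == m) + (k == m))%N = alpha k.
  by case: eqVneq => [->|_]; rewrite ?subn0 ?addn0 // subnK.
have sum1 l : (\sum_k (k == l :> 'I_D.+1) = 1)%N.
  by rewrite (bigD1 l) //= eqxx big1 // => k /negPf ->.
apply/and5P; split=> //; apply/andP; split.
  (* Removing and restoring the unit at [m] gives both degrees the same main sum, plus one. *)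
  rewrite -dega /mdegree; under [X in _ == X]eq_bigr do rewrite -alphaE.
  under eq_bigr do rewrite ffunE.
  by rewrite !big_split /= !sum1.
rewrite -suppa; apply/eqP/setP => k; rewrite !inE ffunE addn_gt0.
case: (eqVneq k m) => [->|_]; first by rewrite am orbT.
by rewrite subn0 lt0b -orbA.
Qed.

Theorem theorem12 (R : realType) (D r : nat) (hD : (1 <= D)%N) (hr : (1 <= r)%N)
    (v : 'I_D.+1 -> 'rV[R]_D) (hv : nondegenerate_simplex v)
    (xi lam : 'I_D.+1 -> 'rV[R]_D -> R^o)
    (hxi : is_barycentric v xi) (hlam : is_barycentric v lam)
    (A : 'S_D.+1 -> 'rV[R]_D -> 'rV[R]_D)
    (hA : forall s : 'S_D.+1, is_relabelling_map v s (A s))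
    (f : {set 'I_D.+1}) (e : label_pair D) (alpha : multiexp D)
    (hB : (f, e, alpha) \in Bminus D r)
    (p : 'S_D.+1) :
  let eps : R := pair_sign R (relabel_pair p e) in
  let ep := sort_pair (relabel_pair p e) in
  let fp := relabel_face p f in
  let alphap := relabel_exp p alpha in
  let m := min_label fp in
  let pulled := pullback (A (p^-1)%g) (wform xi f e alpha) in
  [/\ eq_on v pulled (eps *: fmul (bern lam alphap) (whitney lam ep)),
      ep.1 = m <-> (p^-1)%g m \in [set e.1; e.2]
    & exactly_one
        [/\ ep.1 = m,
            anchored fp ep,
            eq_on v pulled (eps *: wform lam fp ep alphap)
          & (fp, ep, alphap) \in Bminus D r]
        [/\ ep.1 <> m,
            eq_on v pulled
              (eps *: (wform lam fp (m, ep.2) (mshift m ep.1 alphap)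
                       - wform lam fp (m, ep.1) (mshift m ep.2 alphap))),
            (fp, (m, ep.2), mshift m ep.1 alphap) \in Bminus D r
          & (fp, (m, ep.1), mshift m ep.2 alphap) \in Bminus D r]].
Proof.
move=> eps ep fp alphap m pulled.
have /andP[hS _] := hB.
have hS' : (fp, ep, alphap) \in Sminus D r := Sminus_relabel p hS.
have lt_ep : (ep.1 < ep.2)%N.
  apply: sort_pair_lt; rewrite (inj_eq perm_inj).
  by have /and5P[] := hS.
have [ep1f ep2f supp_fp] : [/\ ep.1 \in fp, ep.2 \in fp
    & msupp alphap :|: [set ep.1; ep.2] = fp].
  by have /and5P[_ _ ? ? /andP[_ /eqP]] := hS'.
have [mf m_min] := min_labelP ep1f; rewrite -/m in mf m_min.
(* Sorting leaves [ep.1] as the only endpoint that can equal the minimum [m]. *)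
have ltm2 : (m < ep.2)%N := leq_ltn_trans (m_min _ ep1f) lt_ep.
have m_ne2 : m != ep.2 by rewrite -val_eqE ltn_eqF.
have pulledE : pulled = eps *: fmul (bern lam alphap) (whitney lam ep).
  have [[xiA _] [FA _]] := (hxi, hA (p^-1)%g).
  rewrite /pulled (pullback_wform f e alpha xiA FA
    (barycentric_relabel hv hxi hlam (hA (p^-1)%g))).
  by rewrite whitney_sort fmulZ.
have mem_m : ((p^-1)%g m \in [set e.1; e.2]) = (ep.1 == m).
  rewrite !inE !(can2_eq (permKV p) (permK p)).
  have : (m \in [set ep.1; ep.2]) = (m \in [set p e.1; p e.2]).
    by rewrite sort_pair_set.
  by rewrite !inE (negPf m_ne2) orbF eq_sym => ->.
split; first by rewrite pulledE.
  by rewrite mem_m; split=> /eqP.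
(* The alternatives exclude each other through their first clauses, [ep.1 = m] and its negation. *)
have [ep1m|ep1m] := eqVneq ep.1 m; [left; split; last by case|right; split].
- have anch : anchored fp ep by rewrite /anchored lt_ep ep1m eqxx.
  by split=> //; [rewrite pulledE | rewrite inE hS'].
- by case=> /eqP; rewrite (negPf ep1m).
have m_ne1 : m != ep.1 by rewrite eq_sym.
have am : (0 < alphap m)%N.
  by move: mf; rewrite -supp_fp !inE (negPf m_ne1) (negPf m_ne2) !orbF.
have ltm1 : (m < ep.1)%N by rewrite ltn_neqAle val_eqE m_ne1 m_min.
have hS1 : (fp, (ep.1, ep.2), alphap) \in Sminus D r.
  by rewrite -(surjective_pairing ep).
split; first exact/eqP.
- by rewrite pulledE (whitney_filter_hit lam fp ep am).
- by rewrite inE /anchored ltm2 eqxx !andbT (Sminus_mshift hS1 am m_ne2).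
(* In this triplet [m] takes the place of [ep.2], so the endpoints are swapped before the
   exchange. *)
- by rewrite inE /anchored ltm1 eqxx !andbT
    (Sminus_mshift (Sminus_swap hS1) am m_ne1).
Qed.
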